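(* Let $X$ be a Lindelöf Hausdorff pseudoradial space. Then $F(X_\delta) \leq 2^{F(X)}$.
   Context: A space is Lindelöf if every open cover has a countable subcover (no regularity is assumed). A transfinite sequence $\{x_\alpha : \alpha < \kappa\}$ ($\kappa$ an infinite cardinal) converges to a point $x$ if every open neighbourhood of $x$ contains $\{x_\alpha : \beta \leq \alpha < \kappa\}$ for some $\beta < \kappa$. A topological space $X$ is pseudoradial if for every non-closed set $A \subset X$ there are a point $x \in \overline{A} \setminus A$ and a transfinite sequence $\{x_\alpha : \alpha < \kappa\} \subset A$ which converges to $x$. $X_\delta$ denotes the set $X$ endowed with the $G_\delta$ topology, i.e. the topology generated by the $G_\delta$-subsets of $X$ (countable intersections of open subsets of $X$). A sequence $\{y_\alpha : \alpha < \kappa\}$ in a space $Y$ is free if $\overline{\{y_\alpha : \alpha < \beta\}} \cap \overline{\{y_\alpha : \beta \leq \alpha < \kappa\}} = \emptyset$ for every $\beta < \kappa$. $F(Y)$ is the supremum of the cardinalities of free sequences in $Y$. As is standard, all cardinal functions are taken to be infinite (so $F(Y)$ means $\max\{\omega, F(Y)\}$). *)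

(* Defs.v *)
From HB Require Import structures.
From mathcomp Require Import all_boot all_classical wochoice topology.
From mathcomp Require Import borel_hierarchy.
Set Implicit Arguments.
Unset Strict Implicit.
Unset Printing Implicit Defensive.
Local Open Scope classical_set_scope.
Local Open Scope card_scope.

Definition lindelof_space (X : topologicalType) : Prop :=
  forall F : set (set X),
    (forall U, F U -> open U) -> \bigcup_(U in F) U = [set: X] ->
    exists G : set (set X),
      [/\ G `<=` F, countable G & \bigcup_(U in G) U = [set: X]].

(* Cardinals are represented as initial ordinals: [(K, le)] is a (reflexively)
   well-ordered type none of whose proper initial segments [{b | b < a}] has
   the cardinality of [K].  Finite cardinals are included. *)
Definition cardinal_order (K : Type) (le : rel K) : Prop :=
  well_order le /\
  forall a : K, ~ ([set: K] #<= [set b | ~~ le a b]).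

Definition seq_converges (X : topologicalType) (K : Type) (le : rel K)
    (s : K -> X) (x : X) : Prop :=
  forall U : set X, open_nbhs x U ->
    exists b : K, s @` [set a | le b a] `<=` U.

Definition pseudoradial_space (X : topologicalType) : Prop :=
  forall A : set X, ~ closed A ->
    exists (x : X) (K : Type) (le : rel K) (s : K -> X),
      [/\ (closure A `\` A) x,
          cardinal_order le /\ infinite_set [set: K],
          range s `<=` A &
          seq_converges le s x].

(* Gdelta sets are used as a subbase (the index of a set is the set itself). *)
Definition Gdelta_space (X : topologicalType) : Type := X.

HB.instance Definition _ (X : topologicalType) :=
  Choice.on (Gdelta_space X).
HB.instance Definition _ (X : topologicalType) :=
  isSubBaseTopological.Build (Gdelta_space X)
    (@Gdelta X : set (set X)) id.

Definition free_sequence (Y : topologicalType) (K : Type) (le : rel K)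
    (y : K -> Y) : Prop :=
  forall b : K,
    closure (y @` [set a | ~~ le b a]) `&` closure (y @` [set a | le b a])
      = set0.

(* Cardinals are taken up to equipotence here: [L] stands for the cardinal of
   [[set: L]]. *)
Definition free_sequence_bound (Y : topologicalType) (L : Type) : Prop :=
  infinite_set [set: L] /\
  forall (K : Type) (le : rel K) (y : K -> Y),
    cardinal_order le -> free_sequence le y -> range y #<= [set: L].

Lemma inj_card_leT (T U : Type) (f : T -> U) :
  injective f -> [set: T] #<= [set: U].
Proof.
by move=> f_inj; rewrite -(card_le_eql (inj_card_eq (in2W f_inj))) card_leT.
Qed.

(* Any nonempty family of cardinals has a least member: take a maximal set of
   points of the product of the family that pairwise differ in every
   coordinate; it projects onto one of the factors. *)
Lemma card_le_least (I : Type) (T : I -> Type) (i0 : I) :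
  exists i, forall j, [set: T i] #<= [set: T j].
Proof.
pose apart (S : set (forall i, T i)) :=
  forall f g, S f -> S g -> (exists i, f i = g i) -> f = g.
have [S [Sap Smax]] : exists S, apart S /\ forall S', S `<` S' -> ~ apart S'.
  apply: Zorn_bigcup => F Fap Ftot f g [A FA Af] [B FB Bg].
  have [AB|BA] := Ftot _ _ FA FB.
  - by apply: (Fap B FB) => //; exact: AB.
  - by apply: (Fap A FA) => //; exact: BA.
have [i surj_i] : exists i, forall x : T i, exists f, S f /\ f i = x.
  apply: contrapT => /forallNP nsurj.
  have {nsurj} miss i : exists x : T i, forall f, S f -> f i <> x.
    have /existsNP[x nx] := nsurj i.
    by exists x => f Sf fx; apply: nx; exists f.
  pose h i := projT1 (cid (miss i)).
  have hS f i : S f -> f i <> h i.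
    by move=> Sf; rewrite /h; case: cid => x /= /(_ f Sf).
  apply: (Smax (S `|` [set h])).
    split=> [f Sf|subS]; first by left.
    have Sh : S h by apply: subS; right.
    exact: (hS h i0 Sh erefl).
  move=> f g [Sf|->] [Sg|->] // [j fgj].
  - by apply: Sap => //; exists j.
  - by case: (hS f j Sf).
  - by case: (hS g j Sg).
pose g (x : T i) := projT1 (cid (surj_i x)).
have gS x : S (g x) by rewrite /g; case: cid => f /= [].
have gi x : g x i = x by rewrite /g; case: cid => f /= [].
exists i => j.
apply: (@inj_card_leT _ _ (fun x : T i => g x j)) => x y gxy.
by rewrite -[x]gi -[y]gi (Sap (g x) (g y)) //; exists j.
Qed.

Lemma card_le_total (T U : Type) :
  [set: T] #<= [set: U] \/ [set: U] #<= [set: T].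
Proof.
have [[] le_i] := card_le_least (fun b : bool => if b then T else U) true.
- by left; exact: (le_i false).
- by right; exact: (le_i true).
Qed.

Lemma free_sequence_bound_le (Y : topologicalType) (L M : Type) :
  [set: L] #<= [set: M] -> free_sequence_bound Y L -> free_sequence_bound Y M.
Proof.
move=> LM [/infiniteP Linf Lub]; split.
  by apply/infiniteP; exact: card_le_trans Linf LM.
by move=> K le y Kcard yfree; exact: card_le_trans (Lub _ _ _ Kcard yfree) LM.
Qed.

Lemma free_sequence_sup_exists (Y : topologicalType) :
  exists L, free_sequence_bound Y L /\
    forall M, free_sequence_bound Y M -> [set: L] #<= [set: M].
Proof.
pose W : Type := (Y + nat)%type.
have Wbound : free_sequence_bound Y W.
  split; first by apply/infiniteP; exact/inj_card_leT/inr_inj.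
  move=> K le y _ _; apply: card_le_trans (card_leT _) _.
  exact/inj_card_leT/inl_inj.
have Tbound : free_sequence_bound Y [set: W].
  apply: free_sequence_bound_le Wbound.
  by rewrite (card_le_eqr (card_setT _)).
pose I := {S : set W | free_sequence_bound Y S}.
have [[S Sbound] Sleast] :=
  card_le_least (fun i : I => set_type (sval i)) (exist _ setT Tbound).
exists S; split=> // M Mbound.
have [WM|MW] := card_le_total W M.
  by apply: card_le_trans WM; rewrite (card_le_eql (card_setT S)) card_leT.
have /card_subP[C CM _] := MW.
have Cbound : free_sequence_bound Y C.
  apply: free_sequence_bound_le Mbound.
  by rewrite (card_le_eqr (card_setT C)) (card_le_eqr CM).
by rewrite -(card_le_eqr CM) -(card_le_eqr (card_setT C));
  exact: Sleast (exist _ C Cbound).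
Qed.

(* [F(Y)]: a type whose cardinality is the least infinite cardinal bounding
   the cardinalities of all free sequences of [Y], i.e. their supremum, made
   infinite. It is determined up to equipotence. *)
Definition free_number (Y : topologicalType) : Type :=
  projT1 (cid (free_sequence_sup_exists Y)).

Lemma free_numberP (Y : topologicalType) :
  free_sequence_bound Y (free_number Y) /\
  forall M, free_sequence_bound Y M -> [set: free_number Y] #<= [set: M].
Proof. exact: projT2 (cid (free_sequence_sup_exists Y)). Qed.

(* Main.v *)
Require Import Defs.
From mathcomp Require Import all_boot all_classical wochoice topology.
From mathcomp Require Import borel_hierarchy.

(** Write k for the cardinal F(X), represented by a type [L]; the cardinal 2^k
is then represented by [set L].

The tightness of [X] is at most k ([small_tightness]). Otherwise some
non-closed [A] contains the closures of its subsets of size at most k, and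
pseudoradiality gives a sequence in [A] converging to a point [p] outside [A].
The closure of a small subset [S] of [A] misses [p], so by the Hausdorff and
Lindelof properties it lies in an open set which avoids a tail of the sequence.
Choosing terms of the sequence outside all the open sets obtained so far yields
a free sequence of length k^+, which is impossible.

Tightness at most k in a Lindelof Hausdorff space controls the G-delta topology
in two ways, both by closing a set off under operations of arity k, which costs
only (2^k)^k = 2^k points ([op_closure]):
- its tightness is at most 2^k ([Gdelta_tightness]);
- every cover by G-delta sets has a subcover of size at most 2^k
  ([Gdelta_lindelof_number]).
In both arguments a countable family of open sets, each determined by at most k
points of the closed-off set, covers that set; if it failed to cover
everything, one of the operations would have produced an uncovered point of the
closed-off set.

Finally, suppose that the G-delta topology has a free sequence of length
(2^k)^+. By the tightness bound and the regularity of (2^k)^+, a point in the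
closure of the whole sequence is in the closure of an initial segment, hence by
freeness not in the closure of some tail. So every point has a G-delta
neighbourhood missing a tail. At most 2^k of these sets cover the space, and
by regularity they all miss a common tail: a contradiction. *)

Set Implicit Arguments.
Unset Strict Implicit.
Unset Printing Implicit Defensive.
Local Open Scope classical_set_scope.
Local Open Scope card_scope.

(** * Cardinal arithmetic *)

Lemma card_leT_injP (T U : Type) :
  [set: T] #<= [set: U] <-> exists f : T -> U, injective f.
Proof.
split=> [/card_leP[g]|[f /inj_card_leT//]].
exists (fun x => sval (g (SigSub (in_setT x)))) => x y /val_inj gxy.
by have /(congr1 sval) := inj (f := g) (in_setT _) (in_setT _) gxy.
Qed.

Lemma card_le_injP (T U : Type) (A : set T) (B : set U) (b : U) :
  A #<= B -> exists2 f : T -> U, (forall x, A x -> B (f x)) & set_inj A f.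
Proof.
elim/Ppointed: U => U in B b *; first by have := no b.
by move=> /pcard_leP/injfunPex[f]; exists f.
Qed.

Lemma card_le_setT_total (T U : Type) (A : set T) (B : set U) :
  A #<= B \/ B #<= A.
Proof.
have := card_le_total A B.
by rewrite !(card_le_eql (card_setT _)) !(card_le_eqr (card_setT _)).
Qed.

Lemma card_le_range (T U : Type) (A : set T) :
  A #<= [set: U] -> A !=set0 -> exists f : U -> T, A = range f.
Proof. by move=> /pfcard_geP[->[]//|/surjfunPex]. Qed.

Lemma card_le_prod (T T' U U' : Type) :
  [set: T] #<= [set: U] -> [set: T'] #<= [set: U'] ->
  [set: T * T'] #<= [set: U * U'].
Proof.
move=> /card_leT_injP[f fI] /card_leT_injP[g gI]; apply/card_leT_injP.
by exists (fun p => (f p.1, g p.2)) => -[x x'] [y y'] [/fI-> /gI->].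
Qed.

(** [G] is the graph of an injection of [D * D] into [D]. Graphs rather than
functions are used because a union of a chain of graphs is again a graph, as
Zorn's lemma requires. *)
Definition square_on (T : Type) (G : set (T * T * T)) (D : set T) :=
  [/\ forall p z z', G (p, z) -> G (p, z') -> z = z',
      forall p q z, G (p, z) -> G (q, z) -> p = q,
      forall x y z, G (x, y, z) -> [/\ D x, D y & D z]
    & forall x y, D x -> D y -> exists z, G (x, y, z)].

(** Zorn's lemma gives a maximal subset [D], extending a copy of [nat], with an
injection of [D * D] into [D]. If the complement of [D] embeds in [D], then the
whole type embeds in [D]: two points [a], [b] of [D] tag which side an element
comes from. Otherwise the complement contains a copy [E] of [D], and the three
blocks of the square of [D `|` E] outside [D * D] can be sent injectively
into [E], against maximality. *)
Lemma card_square (T : Type) :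
  infinite_set [set: T] -> [set: T * T] #<= [set: T].
Proof.
move=> /infiniteP/card_leT_injP[j jI].
have /card_leT_injP[pr prI] : [set: nat * nat] #<= [set: nat].
  by rewrite (card_le_eql card_nat2).
pose G0 : set (T * T * T) :=
  [set w | exists m n, w = (j m, j n, j (pr (m, n)))].
pose D0 : set T := range j.
have sq0 : square_on G0 D0.
  split.
  - by move=> p z z' [m [n [-> ->]]] [m' [n' [/jI<- /jI<- ->]]].
  - by move=> p q z [m [n [-> ->]]] [m' [n' [-> /jI/prI[-> ->]]]].
  - by move=> x y z [m [n [-> -> ->]]]; split; eexists.
  - by move=> _ _ [m _ <-] [n _ <-]; exists (j (pr (m, n))), m, n.
pose dom (G : set (T * T * T)) : set T := [set x | exists z, G (x, x, z)].
have sq_dom G D : square_on G D -> D = dom G.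
  case=> _ _ GD DG; apply/seteqP; split=> [x Dx|x [z /GD[]//]].
  by have [z] := DG x x Dx Dx; exists z.
(* The empty graph is allowed because the empty chain has an empty union. *)
pose P G := G = set0 \/ (G0 `<=` G /\ square_on G (dom G)).
have [G [PG Gmax]] : exists G, P G /\ forall G', G `<` G' -> ~ P G'.
  apply: Zorn_bigcup => F FP Ftot.
  have [[G FG G0G]|F0] := pselect (exists2 G, F G & G0 `<=` G); last first.
    left; rewrite -subset0 => w [G FG Gw].
    have [G0'|[sG _]] := FP _ FG; first by rewrite G0' in Gw.
    by case: F0; exists G.
  right; split; first by move=> w /G0G; exists G.
  have sqF H w : F H -> H w -> square_on H (dom H).
    by move=> FH; have [->|[]] := FP _ FH.
  have dir H H' w w' : F H -> F H' -> H w -> H' w' ->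
      exists2 H2, F H2 & H2 w /\ H2 w' /\ square_on H2 (dom H2).
    move=> FH FH' Hw Hw'; have [HH|HH] := Ftot _ _ FH FH'.
    - by exists H' => //; split; [exact: HH|split=> //; exact: sqF Hw'].
    - by exists H => //; do 2?split=> //; [exact: HH|exact: sqF Hw].
  split.
  - move=> p z z' [H FH Hz] [H' FH' Hz'].
    have [H2 _ [Hp [Hq [fct _ _ _]]]] := dir _ _ _ _ FH FH' Hz Hz'.
    exact: fct Hp Hq.
  - move=> p q z [H FH Hz] [H' FH' Hz'].
    have [H2 _ [Hp [Hq [_ ij _ _]]]] := dir _ _ _ _ FH FH' Hz Hz'.
    exact: ij Hp Hq.
  - move=> x y z [H FH Hz].
    have [H2 FH2 [_ [H2z [_ _ H2D _]]]] := dir _ _ _ _ FH FH Hz Hz.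
    by have [[a ?] [b ?] [c ?]] := H2D _ _ _ H2z;
      split; [exists a; exists H2|exists b; exists H2|exists c; exists H2].
  - move=> x y [a [H FH Ha]] [b [H' FH' Hb]].
    have [H2 FH2 [H2a [H2b [_ _ _ H2D]]]] := dir _ _ _ _ FH FH' Ha Hb.
    have [||z] := H2D x y; [by exists a|by exists b|].
    by exists z; exists H2.
have [G_eq0|[G0G sqG]] := PG.
  exfalso; apply: (Gmax G0); last first.
    by right; split=> //; rewrite -(sq_dom _ _ sq0).
  rewrite G_eq0; split=> // /(_ (j 0, j 0, j (pr (0, 0)))); apply.
  by exists 0, 0.
set D := dom G in sqG; have [Gfct Ginj GD DG] := sqG.
have /choice[g gG] : forall p : T * T, exists z, D p.1 -> D p.2 -> G (p, z).
  move=> [x y] /=; have [[Dx Dy]|nD] := pselect (D x /\ D y).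
    by have [z] := DG x y Dx Dy; exists z.
  by exists x => Dx Dy; case: nD.
have gD x y : D x -> D y -> D (g (x, y)).
  by move=> Dx Dy; have /GD[] := gG (x, y) Dx Dy.
have gI x y x' y' : D x -> D y -> D x' -> D y' ->
    g (x, y) = g (x', y') -> x = x' /\ y = y'.
  move=> Dx Dy Dx' Dy' e.
  have Gp := gG (x, y) Dx Dy; have Gq := gG (x', y') Dx' Dy'.
  by rewrite e in Gp; case: (Ginj _ _ _ Gp Gq).
pose a := j 0; pose b := j 1.
have Dj n : D (j n) by exists (j (pr (n, n))); apply: G0G; exists n, n.
have Da : D a := Dj 0; have Db : D b := Dj 1.
have ab : a <> b by move=> /jI.
(* Either [T] is no larger than [D], or [D] can be enlarged. *)
have [nDD|DnD] := card_le_setT_total (~` D) D.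
  have [f fD fI] := card_le_injP a nDD.
  pose h x := if pselect (D x) then g (a, x) else g (b, f x).
  have hD x : D (h x).
    by rewrite /h; case: pselect => [Dx|nDx]; apply: gD => //; exact: fD.
  have hI : injective h.
    move=> x y; rewrite /h.
    case: pselect => [Dx|nDx]; case: pselect => [Dy|nDy].
    - by case/gI.
    - by case/gI => //; exact: fD.
    - by case/gI => //; [exact: fD|move=> /esym].
    - case/gI => //; [exact: fD|exact: fD|move=> _].
      by apply: fI; rewrite inE.
  apply/card_leT_injP; exists (fun p => g (h p.1, h p.2)) => -[x y] [x' y'] /=.
  by case/gI => // /hI-> /hI->.
exfalso; have [e eD eI] := card_le_injP a DnD.
pose E := e @` D; pose D' := D `|` E.
have /choice[c cP] : forall x, exists y,
    D' x -> D y /\ (D x -> y = x) /\ (~ D x -> e y = x).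
  move=> x; have [Dx|nDx] := pselect (D x); first by exists x.
  have [[y Dy eyx]|nEx] := pselect (E x); first by exists y.
  by exists x => -[].
(* The tags [s] and the codes [c] in [D] determine the points of [D']. *)
pose s x := if pselect (D x) then a else b.
have sD x : D (s x) by rewrite /s; case: pselect.
have cD x : D' x -> D (c x) by move=> /cP[].
have scI x y : D' x -> D' y -> s x = s y -> c x = c y -> x = y.
  move=> /cP[_ [xD xE]] /cP[_ [yD yE]]; rewrite /s.
  case: pselect => [Dx|nDx]; case: pselect => [Dy|nDy] // sxy cxy.
  - by rewrite -xD // -yD.
  - by case: ab.
  - by rewrite -xE // -yE // cxy.
pose k x y := e (g (g (s x, s y), g (c x, c y))).
have kD x y : D' x -> D' y -> D (g (g (s x, s y), g (c x, c y))).
  by move=> /cD ? /cD ?; apply: (gD); exact: gD.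
have kI x y x' y' : D' x -> D' y -> D' x' -> D' y' ->
    k x y = k x' y' -> (x, y) = (x', y').
  move=> Dx Dy Dx' Dy' /eI; rewrite !inE => /(_ (kD _ _ Dx Dy) (kD _ _ Dx' Dy')).
  have cDx := cD _ Dx; have cDy := cD _ Dy.
  have cDx' := cD _ Dx'; have cDy' := cD _ Dy'.
  case/gI; try exact: gD.
  move=> /gI[]// ss ss' /gI[]// cc cc'.
  by congr pair; exact: scI.
pose G' := G `|` [set w | [/\ D' w.1.1, D' w.1.2, ~ (D w.1.1 /\ D w.1.2)
                            & w.2 = k w.1.1 w.1.2]].
have kN x y : D' x -> D' y -> ~ D (k x y) by move=> Dx Dy; apply: eD; exact: kD.
have sqG' : square_on G' D'.
  split.
  - move=> [x y] z z' [Gz|/=[Dx Dy nD ->]] [Gz'|/=[Dx' Dy' nD' ->]] //.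
    + exact: Gfct Gz Gz'.
    + by case: nD'; case: (GD _ _ _ Gz).
    + by case: nD; case: (GD _ _ _ Gz').
  - move=> [x y] [x' y'] z [Gz|/=[Dx Dy nD ->]] [Gz'|/=[Dx' Dy' nD' zk]].
    + exact: Ginj Gz Gz'.
    + by case: (kN x' y') => //; rewrite -zk; case: (GD _ _ _ Gz).
    + by case: (kN x y) => //; case: (GD _ _ _ Gz').
    + exact: kI zk.
  - move=> x y z [/GD[? ? ?]|/=[Dx Dy _ ->]]; first by split; left.
    by split=> //; right; exists (g (g (s x, s y), g (c x, c y))) => //; exact: kD.
  - move=> x y Dx Dy; have [[? ?]|nD] := pselect (D x /\ D y).
      by exists (g (x, y)); left; exact: gG.
    by exists (k x y); right.
apply: (Gmax G'); last by right; rewrite -(sq_dom _ _ sqG'); split=> // w /G0G; left.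
split=> [w|G'G]; first by left.
have D'e : D' (e a) by right; exists a.
have /G'G/GD[] : G' (e a, e a, k (e a) (e a)).
  by right; split=> // -[/(eD a Da)].
by move=> /(eD a Da).
Qed.

Lemma card_le_bigcup (J T L : Type) (D : set J) (F : J -> set T) :
  [set: L * L] #<= [set: L] -> D #<= [set: L] ->
  (forall j, D j -> F j #<= [set: L]) ->
  \bigcup_(j in D) F j #<= [set: L].
Proof.
move=> LL DL FL; have [U0|/set0P[x [j Dj Fjx]]] := eqVneq (\bigcup_(j in D) F j) set0.
  by rewrite U0.
have [d Dd] := card_le_range DL (ex_intro _ j Dj).
have /choice[f fF] : forall l : L, exists f : L -> T, F (d l) `<=` range f.
  move=> l; have [F0|F0] := eqVneq (F (d l)) set0.
    by exists (fun=> x); rewrite F0.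
  have Fdl : F (d l) #<= [set: L] by apply: FL; rewrite Dd; exists l.
  by have /set0P/(card_le_range Fdl)[f ->] := F0; exists f.
apply: card_le_trans LL.
apply: card_le_trans (card_image_le (fun p => f p.1 p.2) _).
apply: subset_card_le => y [i]; rewrite {1}Dd => -[l _ <-] /fF[m _ <-].
by exists (l, m).
Qed.

Lemma card_le_setU (T L : Type) (A B : set T) :
  infinite_set [set: L] -> A #<= [set: L] -> B #<= [set: L] ->
  A `|` B #<= [set: L].
Proof.
move=> Linf AL BL; rewrite -bigcup2inE.
apply: card_le_bigcup; first exact: card_square.
  by apply: card_le_trans (card_leT _) _; exact/infiniteP.
by move=> [|[|j]] _ //=.
Qed.

Lemma card_le_option (T L : Type) :
  infinite_set [set: L] -> [set: T] #<= [set: L] -> [set: option T] #<= [set: L].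
Proof.
move=> Linf TL.
have -> : [set: option T] = some @` [set: T] `|` [set None].
  by apply/seteqP; split=> // -[x|] _; [left; exists x|right].
apply: card_le_setU => //; first by rewrite (card_le_eql card_some).
apply: card_le_trans (countable1 None) _; exact/infiniteP.
Qed.

(** The length is recorded next to the folded code, since the code of the empty
list is not distinguished from the other values. *)
Lemma card_le_seq (T L : Type) :
  infinite_set [set: L] -> [set: T] #<= [set: L] -> [set: seq T] #<= [set: L].
Proof.
move=> Linf /card_leT_injP[j jI].
have /card_leT_injP[n nI] := (infiniteP _).1 Linf.
have /card_leT_injP[p pI] := card_square Linf.
pose c s := foldr (fun x l => p (j x, l)) (n 0) s.
apply/card_leT_injP; exists (fun s => p (n (size s), c s)) => s t.
move=> /pI[/nI]; elim: s t => [|x s IH] [|y t] //= [st] /pI[/jI-> cst].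
by rewrite (IH t).
Qed.

Lemma card_le_powerset (L : Type) : [set: L] #<= [set: set L].
Proof.
apply/card_leT_injP; exists (fun x => [set x]) => x y xy.
by have : [set y] x by rewrite -xy.
Qed.

Lemma infinite_powerset (L : Type) :
  infinite_set [set: L] -> infinite_set [set: set L].
Proof.
move=> /infiniteP Linf; apply/infiniteP.
exact: card_le_trans Linf (card_le_powerset L).
Qed.

(** This is (2^k)^k = 2^(k*k) = 2^k: a function is coded by its graph. *)
Lemma card_le_fun (I P L : Type) :
  infinite_set [set: L] -> [set: I] #<= [set: L] -> [set: P] #<= [set: set L] ->
  [set: I -> P] #<= [set: set L].
Proof.
move=> Linf /card_leT_injP[j jI] /card_leT_injP[g gI].
have /card_leT_injP[e eI] := card_square Linf.
apply/card_leT_injP.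
exists (fun f => [set z | exists i x, g (f i) x /\ z = e (j i, x)]).
have sub f f' i : [set z | exists i x, g (f i) x /\ z = e (j i, x)] `<=`
    [set z | exists i x, g (f' i) x /\ z = e (j i, x)] -> g (f i) `<=` g (f' i).
  move=> ff' x gx; have [] := ff' (e (j i, x)); first by exists i, x.
  by move=> i' [x' [gx' /eI[/jI-> ->]]].
by move=> f f' /seteqP[ff' f'f]; apply/funext => i; apply: gI; apply/seteqP;
   split; exact: sub.
Qed.

(** Terms built from one base point with operations of arity [I], one for each
element of [P]; their values form the set generated by the base point. *)
Inductive op_term (P I : Type) : Type :=
| Base
| Op of P & (I -> op_term P I).

Section op_term.
Variables (P I T : Type) (Phi : P -> (I -> T) -> T) (x0 : T).

Fixpoint op_eval (t : op_term P I) : T :=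
  if t is Op p f then Phi p (fun i => op_eval (f i)) else x0.

(** A term is a well-founded tree branching over [I]; this is the label of the
node that a path from the root reaches. *)
Fixpoint op_label (t : op_term P I) (s : seq I) {struct t} : option P :=
  match t, s with
  | Base, _ => None
  | Op p _, [::] => Some p
  | Op _ f, i :: s' => op_label (f i) s'
  end.

Lemma op_label_inj : injective op_label.
Proof.
elim=> [|p f IH] [|q g] // e; try by have := congr1 (@^~ [::]) e.
have [->] : Some p = Some q by have := congr1 (@^~ [::]) e.
congr Op; apply/funext => i; apply: IH; apply/funext => s.
by have := congr1 (@^~ (i :: s)) e.
Qed.

Lemma card_op_term (L : Type) :
  infinite_set [set: L] -> [set: I] #<= [set: L] -> [set: P] #<= [set: set L] ->
  [set: op_term P I] #<= [set: set L].
Proof.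
move=> Linf IL PL; apply: card_le_trans (inj_card_leT op_label_inj) _.
apply: card_le_fun => //; first exact: card_le_seq.
by apply: card_le_option => //; exact: infinite_powerset.
Qed.

End op_term.

(** The set generated from a point by 2^k operations of arity k has at most 2^k
elements. A well-founded tree is determined by its labels along finite paths,
so there are at most (2^k)^k terms; counting terms avoids iterating the
operations along the ordinals below k^+. *)
Lemma op_closure (L P I T : Type) (Phi : P -> (I -> T) -> T) (x0 : T) (A : set T) :
  infinite_set [set: L] -> [set: I] #<= [set: L] -> [set: P] #<= [set: set L] ->
  A x0 -> (forall p f, A (Phi p f)) ->
  exists C : set T, [/\ C x0, C `<=` A, C #<= [set: set L]
    & forall p f, (forall i, C (f i)) -> C (Phi p f)].
Proof.
move=> Linf IL PL Ax0 AP; exists (range (op_eval Phi x0)); split.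
- by exists (Base P I).
- by move=> _ [[|p f] _ <-] //=; exact: AP.
- exact: card_le_trans (card_image_le _ _) (card_op_term Linf IL PL).
- move=> p f Cf.
  have /choice[t tE] : forall i, exists t, op_eval Phi x0 t = f i.
    by move=> i; have [t _ ?] := Cf i; exists t.
  by exists (Op p t) => //=; congr Phi; apply/funext.
Qed.

(** * Well orders and successor cardinals *)

Section well_order.
Variables (K : Type) (le : rel K).
Hypothesis wo : well_order le.

Lemma wo_min (P : set K) : P !=set0 -> exists2 m, P m & forall x, P x -> le m x.
Proof.
move=> [x Px]; have [|m [[/asboolP Pm mP] _]] := wo (A := fun x => `[< P x >]).
  by exists x; apply/asboolP.
by exists m => // y Py; apply: mP; apply/asboolP.
Qed.

Lemma wo_total x y : le x y || le y x.
Proof.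
have [|m [->|->] mP] := @wo_min [set x; y]; first by exists x; left.
  by rewrite mP //; right.
by rewrite orbC mP //; left.
Qed.

Lemma wo_refl x : le x x.
Proof. by have := wo_total x x; rewrite orbb. Qed.

Lemma wo_anti x y : le x y -> le y x -> x = y.
Proof.
move=> xy yx.
have [|m [_ mU]] := wo (A := fun z => `[< z = x \/ z = y >]).
  by exists x; apply/asboolP; left.
have {}mU z : z = x \/ z = y -> m = z.
  move=> zE; apply: mU; split; first exact/asboolP.
  by move=> t /asboolP[->|->]; case: zE => ->; rewrite ?wo_refl.
by rewrite -(mU x) ?(mU y); auto.
Qed.

Lemma wo_trans y x z : le x y -> le y z -> le x z.
Proof.
move=> xy yz; have [|m mE mP] := @wo_min [set t | [\/ t = x, t = y | t = z]].
  by exists x; constructor 1.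
have mx := mP x (Or31 _ _ erefl); have my := mP y (Or32 _ _ erefl).
have mz := mP z (Or33 _ _ erefl).
case: mE => mE; rewrite mE in mx my mz => //.
- by rewrite (wo_anti xy mx).
- by rewrite -(wo_anti yz my).
Qed.

Lemma wo_ltW x y : ~~ le y x -> le x y.
Proof. by move=> nyx; have := wo_total x y; rewrite (negPf nyx) orbF. Qed.

Lemma wo_wf : well_founded (fun x y => ~~ le y x).
Proof.
move=> x; apply: contrapT => nx.
have [m nm mP] := @wo_min [set y | ~ Acc (fun x y => ~~ le y x) y] (ex_intro _ x nx).
apply: nm; constructor => y ym; apply: contrapT => ny.
by rewrite mP in ym.
Qed.

(** The value at [i] may use the earlier values only; the others are masked by
the arbitrary element [t]. *)
Lemma wo_recursion (T : Type) (t : T) (F : K -> (K -> T) -> T) :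
  exists z : K -> T, forall i, z i = F i (fun j => if le i j then t else z j).
Proof.
pose step i (rec : forall j, ~~ le i j -> T) :=
  F i (fun j => if pselect (~~ le i j) is left h then rec j h else t).
exists (Fix wo_wf (fun=> T) step) => i.
rewrite Fix_eq /step => [|x f g fg].
  by congr F; apply/funext => j; case: pselect => [/negPf->|/negP/negPn->].
by congr F; apply/funext => j; case: pselect.
Qed.

End well_order.

Lemma wo_restrict (K : Type) (le : rel K) (D : set K) :
  well_order le -> well_order (fun x y : set_type D => le (val x) (val y)).
Proof.
move=> wo; apply: antisymmetric_well_order.
  by move=> x y /andP[xy yx]; apply/val_inj/(wo_anti wo).
move=> A [x Ax].
have [|m [y [Ay ym] mP]] := wo_min wo (P := [set z | exists y, y \in A /\ val y = z]).
  by exists (val x), x.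
by exists y; split=> // z Az; rewrite ym; apply: mP; exists z.
Qed.

(** Either all proper initial segments embed in [L], and the whole order will
do, or the least point whose initial segment does not embed gives that
segment. *)
Lemma minimal_long_segment (K L : Type) (le : rel K) :
  well_order le -> ~ ([set: K] #<= [set: L]) ->
  exists D : set K, [/\ ~ (D #<= [set: L]) &
    forall x, D x -> [set y | D y /\ ~~ le x y] #<= [set: L]].
Proof.
move=> wo KL.
have [[x xL]|nx] := pselect (exists x, ~ ([set y | ~~ le x y] #<= [set: L])).
  have [m mL mP] := wo_min wo (ex_intro [set x | ~ ([set y | ~~ le x y] #<= [set: L])] x xL).
  exists [set y | ~~ le m y]; split=> // y ym.
  apply: contrapT => yL; move/negP: ym; apply; apply: mP.
  apply: contra_not yL; apply: card_le_trans.
  by apply: subset_card_le => z [].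
exists setT; split=> // x _; apply: contrapT => xL; case: nx; exists x.
by apply: contra_not xL; apply: card_le_trans; apply: subset_card_le => z [].
Qed.

(** A well order longer than the cardinal of [L] contains, as an initial segment,
a copy of the successor of that cardinal. *)
Lemma successor_cardinal_sub (K L : Type) (le : rel K) :
  well_order le -> ~ ([set: K] #<= [set: L]) ->
  exists (K' : Type) (le' : rel K') (e : K' -> K),
    [/\ well_order le', forall x y, le (e x) (e y) = le' x y,
        ~ ([set: K'] #<= [set: L]) &
        forall x, [set y | ~~ le' x y] #<= [set: L]].
Proof.
move=> wo KL; have [D [DL DsL]] := minimal_long_segment wo KL.
exists (set_type D), (fun x y => le (val x) (val y)), val; split=> //.
- exact: wo_restrict.
- by rewrite (card_le_eql (card_setT D)).
- move=> x; apply: card_le_trans (DsL (val x) (set_valP x)).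
  rewrite -(card_le_eql (inj_card_eq (f := val) _)) => [|y z _ _]; last exact: val_inj.
  by apply: subset_card_le => _ [y /= yx <-]; split=> //; exact: set_valP.
Qed.

(** The successor of a cardinal exists: well-order its power set, which is larger
by Cantor's diagonal argument. *)
Lemma successor_cardinal (L : Type) :
  exists (K : Type) (le : rel K),
    [/\ cardinal_order le, ~ ([set: K] #<= [set: L]) &
        forall x, [set y | ~~ le x y] #<= [set: L]].
Proof.
have [le0 wo0] := well_ordering_principle (set L).
have [|K [le [e [wo _ KL KsL]]]] := successor_cardinal_sub (L := L) wo0.
  move=> /card_leT_injP[f fI].
  pose R := [set x | exists A, f A = x /\ ~ A x].
  have [Rf|nRf] := pselect (R (f R)).
    by have [A [/fI AR]] := Rf; rewrite AR.
  by apply: (nRf); exists R.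
exists K, le; split=> //; split=> // x Kx; apply: KL.
exact: card_le_trans Kx (KsL x).
Qed.

Lemma card_le_closed_segment (K L : Type) (le : rel K) (x : K) :
  well_order le -> infinite_set [set: L] ->
  [set y | ~~ le x y] #<= [set: L] -> [set y | le y x] #<= [set: L].
Proof.
move=> wo Linf xL.
have : [set y | ~~ le x y] `|` [set x] #<= [set: L].
  apply: card_le_setU => //; apply: card_le_trans (countable1 x) _.
  exact/infiniteP.
apply: card_le_trans; apply: subset_card_le => y /= yx.
have [xy|] := boolP (le x y); last by left.
by right; exact: (wo_anti wo).
Qed.

(** Successor cardinals are regular: if [D] were unbounded, the order would be a
union of few small initial segments. *)
Lemma successor_regular (K L : Type) (le : rel K) (D : set K) :
  well_order le -> infinite_set [set: L] -> ~ ([set: K] #<= [set: L]) ->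
  (forall x, [set y | ~~ le x y] #<= [set: L]) -> D #<= [set: L] ->
  exists b, forall x, D x -> ~~ le b x.
Proof.
move=> wo Linf KL KsL DL; apply: contrapT => nb; apply: KL.
have -> : [set: K] = \bigcup_(x in D) [set y | le y x].
  apply/seteqP; split=> // b _; apply: contrapT => nU; apply: nb.
  by exists b => x Dx; apply/negP => bx; apply: nU; exists x.
apply: card_le_bigcup => //; first exact: card_square.
by move=> x _; exact: card_le_closed_segment.
Qed.

(** * Lindelof Hausdorff spaces and their G-delta topology *)

Lemma closure_open_disjoint (X : topologicalType) (A U : set X) :
  open U -> A `&` U = set0 -> closure A `&` U = set0.
Proof.
move=> Uo AU; rewrite -subset0 => x [clA Ux].
have [y] : A `&` U !=set0 by apply: clA; exact: open_nbhs_nbhs.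
by rewrite AU.
Qed.

Lemma closure_nonempty (X : topologicalType) (A : set X) (x : X) :
  closure A x -> A !=set0.
Proof. by move=> /(_ setT filterT)[y [Ay _]]; exists y. Qed.

(** A closed subset of a Lindelof space is Lindelof: add its complement to the
cover. The subcover is given as a sequence of indices, with repetitions if
necessary, so that it can be fed to the operations of a fixed arity below. *)
Lemma lindelof_closed_seq (X : topologicalType) (I : Type) (D : set I) (i0 : I)
    (U : I -> set X) (E : set X) :
  lindelof_space X -> closed E -> D i0 -> (forall i, D i -> open (U i)) ->
  E `<=` \bigcup_(i in D) U i ->
  exists i_ : nat -> I, (forall n, D (i_ n)) /\ E `<=` \bigcup_n U (i_ n).
Proof.
move=> XL Ecl Di0 Uo EU.
have [|| G [GF Gc GX]] := XL ([set ~` E] `|` U @` D).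
- move=> _ [->|[i Di <-]]; last exact: Uo.
  exact: closed_openC.
- apply/seteqP; split=> // x _; have [/EU[i Di Ux]|nEx] := pselect (E x).
    by exists (U i) => //; right; exists i.
  by exists (~` E) => //; left.
have [G0|/set0P/(card_le_range Gc)[g Gg]] := eqVneq G set0.
  exists (fun=> i0); split=> // x _.
  by have : [set: X] x by []; rewrite -GX G0 bigcup_set0.
have /choice[i_ i_P] : forall n, exists i, D i /\ (g n = ~` E \/ g n = U i).
  move=> n; have : G (g n) by rewrite Gg; exists n.
  by move=> /GF[->|[i Di <-]]; [exists i0|exists i]; split=> //; [left|right].
exists i_; split=> [n|x Ex]; first by have [] := i_P n.
have : [set: X] x by []; rewrite -GX Gg => -[_ [n _ <-] gx].
by have [_ [gn|gn]] := i_P n; rewrite gn in gx => //; exists n.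
Qed.

(** Without regularity, a point need not be separated from a closed set by two
open sets, but it is avoided by the closures of countably many open sets covering
the closed set. *)
Lemma lindelof_separate (X : topologicalType) (E : set X) (p : X) :
  hausdorff_space X -> lindelof_space X -> closed E -> ~ E p ->
  exists V : nat -> set X,
    (forall n, open (V n) /\ ~ closure (V n) p) /\ E `<=` \bigcup_n V n.
Proof.
move=> XH XL Ecl nEp.
apply: (@lindelof_closed_seq X (set X) [set V | open V /\ ~ closure V p] set0 id)
  => //.
- by split; [exact: open0|rewrite closure0].
- by move=> V [].
- move=> y Ey; have ynp : y != p by apply/eqP => yp; rewrite yp in Ey.
  rewrite open_hausdorff in XH.
  have [[A B] [/= yA pB] [Ao Bo AB]] := XH _ _ ynp.
  exists A; last exact: set_mem; split=> // clAp.
  have : (closure A `&` B) p by split=> //; exact: set_mem.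
  by rewrite closure_open_disjoint // -subset0 => z; rewrite (eqP AB).
Qed.

(** The closures here replace regularity. They matter because the closure of an
open neighbourhood [U] of a limit [x] of [S] contains the closure of [S `&` U],
which has [x] as an element and is determined by points of [S]. *)
Lemma Gdelta_closures (X : topologicalType) (G : set X) (x : X) :
  hausdorff_space X -> lindelof_space X -> Gdelta G -> G x ->
  exists U : nat * nat -> set X,
    (forall i, open (U i) /\ U i x) /\ \bigcap_i closure (U i) `<=` G.
Proof.
move=> XH XL [A Ao ->] Ax.
have /choice[V VP] : forall n, exists V : nat -> set X,
    (forall m, open (V m) /\ ~ closure (V m) x) /\ ~` A n `<=` \bigcup_m V m.
  move=> n; apply: lindelof_separate => //; first exact: open_closedC.
  by apply; exact: Ax.
(* The closed complement of each [A n] is covered by sets whose closures avoid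
   [x]; the complements of these closures are the neighbourhoods. *)
exists (fun i => ~` closure (V i.1 i.2)); split=> [[n m] /=|y clUy n _].
  have [/(_ m)[Vo nVx] _] := VP n.
  by split=> //; exact/closed_openC/closed_closure.
apply: contrapT => nAy; have [Vn /(_ y nAy)[m _ Vy]] := VP n.
have [Vo _] := Vn m.
have : (closure (~` closure (V n m)) `&` V n m) y.
  by split=> //; exact: (clUy (n, m)).
rewrite closure_open_disjoint // -subset0 => z [nz Vz]; apply: nz.
exact: subset_closure.
Qed.

Lemma Gdelta_setI (X : topologicalType) (A B : set X) :
  Gdelta A -> Gdelta B -> Gdelta (A `&` B).
Proof.
move=> [F Fo ->] [G Go ->]; exists (fun n => F n `&` G n).
  by move=> n; exact: openI.
by rewrite bigcapI.
Qed.

Lemma Gdelta_bigcap (X : topologicalType) (J : countType) (F : J -> set X) :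
  (forall i, open (F i)) -> Gdelta (\bigcap_i F i).
Proof.
move=> Fo; exists (fun n => if choice.unpickle n is Some i then F i else setT).
  by move=> n; case: choice.unpickle => [i|]; [exact: Fo|exact: openT].
apply/seteqP; split=> [x Fx n _|x Fx i _].
  by case: choice.unpickle => // i; exact: Fx.
by have := Fx (choice.pickle i) I; rewrite choice.pickleK.
Qed.

(** G-delta sets are closed under finite intersections, so they are a base and
not just a subbase of the G-delta topology. *)
Lemma Gdelta_space_closureP (X : topologicalType) (B : set X) (x : X) :
  closure (B : set (Gdelta_space X)) x <->
  forall G : set X, Gdelta G -> G x -> B `&` G !=set0.
Proof.
split=> [clB G GG Gx|BG U].
  apply: clB; apply: open_nbhs_nbhs; split=> //.
  exists [set G]; last by rewrite bigcup_set1.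
  move=> _ ->; exact: finI_from1.
rewrite nbhsE => -[O [[D DfinI <-] [W DW Wx]] WU].
suff GW : Gdelta (W : set X).
  have [y [By Wy]] := BG _ GW Wx.
  by exists y; split=> //; apply: WU; exists W.
have [E EG <-] := DfinI W DW.
rewrite bigcap_fset big_seq; elim/big_ind: _ => [|A A'|A /EG].
- exact/open_Gdelta/openT.
- exact: Gdelta_setI.
- by rewrite inE.
Qed.

Lemma Gdelta_not_closure (X : topologicalType) (B : set X) (x : X) :
  ~ closure (B : set (Gdelta_space X)) x ->
  exists G : set X, [/\ Gdelta G, G x & B `&` G = set0].
Proof.
move=> nBx; apply: contrapT => nG; apply: nBx; apply/Gdelta_space_closureP.
move=> G GG Gx; apply/set0P/eqP => BG0.
by apply: nG; exists G.
Qed.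

(** * Tightness of Lindelof pseudoradial spaces *)

Definition tightness_le (Y : topologicalType) (L : Type) : Prop :=
  forall (A : set Y) (x : Y), closure A x ->
    exists S, [/\ S `<=` A, S #<= [set: L] & closure S x].

(** This says that the tightness is at most F(X), in terms of sets closed under
closures of small subsets. The free sequence of length k^+ that refutes the
contrary is a subsequence [z] of a sequence [s] converging to [p] outside [A].
Its initial segments [S] are small, so their closures stay in [A]; hence they
miss [p], and the open set [O S] around the closure of [S] avoids a tail
of [s]. *)
Lemma closed_of_small_closures (X : topologicalType) (L : Type) (A : set X) :
  hausdorff_space X -> lindelof_space X -> pseudoradial_space X ->
  free_sequence_bound X L ->
  (forall S, S `<=` A -> S #<= [set: L] -> closure S `<=` A) -> closed A.
Proof.
move=> XH XL Xpr [Linf Lfree] Acl; apply: contrapT => /Xpr.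
move=> [p [K0 [le0 [s [[clAp nAp] [[wo0 _] K0inf] sA sp]]]]].
have [k0 _] := infinite_setN0 K0inf.
(* An unbounded small set of terms of [s] would have [p] in its closure. *)
have bounded (T : set K0) : T #<= [set: L] -> exists b, forall t, T t -> le0 t b.
  move=> TL; apply: contrapT => nb; apply: nAp; apply: (Acl (s @` T)).
  - by move=> _ [t _ <-]; apply: sA; exists t.
  - exact: card_le_trans (card_image_le _ _) TL.
  - move=> N; rewrite nbhsE => -[U Up UN]; have [b bU] := sp _ Up.
    have [t Tt tb] : exists2 t, T t & ~ le0 t b.
      apply: contrapT => nt; apply: nb; exists b => t Tt.
      by apply: contrapT => tb; apply: nt; exists t.
    exists (s t); split; first by exists t.
    apply/UN/bU; exists t => //=; apply: (wo_ltW wo0); exact/negP.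
have sep (S : set X) : exists O, S `<=` A -> S #<= [set: L] ->
    [/\ open O, closure S `<=` O & exists b, forall a, le0 b a -> ~ O (s a)].
  have [[SA SL]|nS] := pselect (S `<=` A /\ S #<= [set: L]); last first.
    by exists set0 => SA SL; case: nS.
  have nSp : ~ closure S p by move=> /(Acl S SA SL).
  have [V [Vp SV]] := lindelof_separate XH XL (@closed_closure _ S) nSp.
  have /choice[b bP] : forall n, exists b, forall a, le0 b a -> ~ V n (s a).
    move=> n; have [Vo nVp] := Vp n.
    have [] := sp (~` closure (V n)).
      by split=> //; exact/closed_openC/closed_closure.
    move=> b bV; exists b => a ba Va; have /= := bV (s a); apply.
      by exists a.
    exact: subset_closure.
  have [c cP] : exists c, forall t, range b t -> le0 t c.
    apply: bounded; apply: card_le_trans (card_image_le _ _) _.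
    exact/infiniteP.
  exists (\bigcup_n V n) => _ _; split=> //.
    by apply: bigcup_open => n _; case: (Vp n).
  exists c => a ca [n _]; apply: bP; apply: (wo_trans wo0) ca.
  by apply: cP; exists n.
have /choice[O OP] := sep.
have [K [le [Kcard KL KsL]]] := successor_cardinal L.
have [wo _] := Kcard.
pose seg (z : K -> X) j := z @` [set k | ~~ le j k].
(* The term at [i] avoids the neighbourhoods of all the segments up to [i],
   including the segment ending just before [i]. *)
pose good z i := [set a | forall j, le j i -> ~ O (seg z j) (s a)].
have /choice[pick pickP] : forall P : set K0, exists a, P !=set0 -> P a.
  by move=> P; have [[a Pa]|nP] := pselect (P !=set0); [exists a|exists k0].
have [z zE] := wo_recursion wo p (fun i z => s (pick (good z i))).
have zA i : A (z i) by apply: sA; rewrite zE; eexists.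
have segP j : [/\ open (O (seg z j)), closure (seg z j) `<=` O (seg z j) &
    exists b, forall a, le0 b a -> ~ O (seg z j) (s a)].
  apply: OP; first by move=> _ [k _ <-].
  exact: card_le_trans (card_image_le _ _) (KsL j).
have zO i j : le j i -> ~ O (seg z j) (z i).
  (* The masking in the recursion does not affect the segments up to [i]. *)
  have segE j' : le j' i -> seg (fun j => if le i j then p else z j) j' = seg z j'.
    move=> ji; apply: eq_imagel => k /= jk; case: ifP => // ik.
    by move/negP: jk; case; exact: (wo_trans wo ji).
  have /pickP : (good (fun j => if le i j then p else z j) i) !=set0.
    have /choice[t tP] : forall j, exists t, forall a, le0 t a -> ~ O (seg z j) (s a).
      by move=> j'; have [_ _ [b bP]] := segP j'; exists b.
    have [c cP] : exists c, forall x, (t @` [set j | le j i]) x -> le0 x c.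
      apply: bounded; apply: card_le_trans (card_image_le _ _) _.
      exact: card_le_closed_segment.
    exists c => j' ji; rewrite segE //; apply: tP; apply: cP.
    by exists j'.
  by move=> /(_ j) + ji => /(_ ji); rewrite segE // -zE.
have zfree : free_sequence le z.
  move=> b; have [Oo segO _] := segP b.
  rewrite -subset0 => x [/segO Ox clx].
  have : (closure (z @` [set a | le b a]) `&` O (seg z b)) x by [].
  rewrite closure_open_disjoint // -subset0 => _ [[a /= ba <-]].
  exact: zO.
have := Lfree K le z Kcard zfree.
rewrite (card_le_eql (inj_card_eq _)) // => i j _ _ zij.
have ninj k l : ~~ le l k -> z k = z l -> False.
  move=> kl zkl; have [Oo segO _] := segP l.
  apply: (zO l l (wo_refl wo l)); rewrite -zkl; apply: segO.
  by apply: subset_closure; exists k.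
apply: (wo_anti wo); apply: contrapT => /negP.
  by move=> /ninj; apply.
by move=> /ninj; apply.
Qed.

(** The limits of small subsets of [A] form a set closed under limits of small
subsets, since k * k = k. *)
Lemma small_tightness (X : topologicalType) (L : Type) :
  hausdorff_space X -> lindelof_space X -> pseudoradial_space X ->
  free_sequence_bound X L -> tightness_le X L.
Proof.
move=> XH XL Xpr XF A x Ax; have [Linf _] := XF.
pose B := [set y | exists S, [/\ S `<=` A, S #<= [set: L] & closure S y]].
suff Bcl : closed B.
  apply: (Bcl x); apply: closureS Ax => y Ay; exists [set y].
  split; first by move=> _ ->.
    by apply: card_le_trans (countable1 y) _; exact/infiniteP.
  exact: subset_closure.
apply: (closed_of_small_closures XH XL Xpr XF) => T TB TL y Ty.
have /choice[S SP] : forall t, exists S : set X,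
    T t -> [/\ S `<=` A, S #<= [set: L] & closure S t].
  move=> t; have [/TB[S ?]|nT] := pselect (T t); first by exists S.
  by exists set0 => /nT.
exists (\bigcup_(t in T) S t); split.
- by move=> z [t /SP[SA _ _]] /SA.
- by apply: card_le_bigcup => //; [exact: card_square|move=> t /SP[]].
- have /closure_id -> : closed (closure (\bigcup_(t in T) S t)) by exact: closed_closure.
  apply: closureS Ty => t Tt; have [_ _] := SP t Tt.
  by apply: closureS => z; exists t.
Qed.

(** * Closing-off arguments for the G-delta topology *)

(** Let [p] be in the G-delta closure of [A]. For each small [S] whose closure
misses [p], fix a countable cover [V S] of that closure by open sets whose
closures avoid [p]. Close [C] off so that whenever a countable union of sets
[V S m], with [S] in [C], fails to contain [A], it fails to contain [C]. If a
G-delta set, the intersection of the open sets [Wn n], contained [p] and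
missed [C], then [C] would be the union of the sets [C `\` Wn n], whose
closures miss [p]; by tightness and the Lindelof property countably many sets
[V S m] would cover [C], hence [A], and the complements of their closures would
intersect in a G-delta set around [p] missing [A]. *)
Lemma Gdelta_tightness (X : topologicalType) (L : Type) :
  hausdorff_space X -> lindelof_space X -> infinite_set [set: L] ->
  tightness_le X L -> tightness_le (Gdelta_space X) (set L).
Proof.
move=> XH XL Linf XT A p /Gdelta_space_closureP Ap.
have [a0 [Aa0 _]] := Ap setT (open_Gdelta openT) I.
have /choice[V VP] : forall S : set X, exists V : nat -> set X,
    (forall m, open (V m) /\ ~ closure (V m) p) /\
    (~ closure S p -> closure S `<=` \bigcup_m V m).
  move=> S; have [Sp|nSp] := pselect (closure S p).
    exists (fun=> set0); split=> // m.
    by split; [exact: open0|rewrite closure0].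
  have [V [Vp SV]] := lindelof_separate XH XL (@closed_closure _ S) nSp.
  by exists V; split.
have /choice[pick pickP] : forall P : set X, exists a,
    A a /\ (A `&` P !=set0 -> P a).
  move=> P; have [[a [Aa Pa]]|nP] := pselect (A `&` P !=set0).
    by exists a.
  by exists a0.
(* Nonempty small sets are coded as ranges of functions on [L], so that a
   sequence of such sets is an argument of arity [(nat * nat) * L]. *)
pose U (gm : (L -> X) * nat) := V (range gm.1) gm.2.
pose Phi (m : nat * nat -> nat) (f : (nat * nat) * L -> X) :=
  pick (~` \bigcup_i U (fun l => f (i, l), m i)).
have natL : [set: nat] #<= [set: L] by exact/infiniteP.
have natnatL : [set: nat * nat] #<= [set: L] by rewrite (card_le_eql card_nat2).
have [|||m f|C [Ca0 CA CL CPhi]] := @op_closure L _ _ _ Phi a0 A Linf.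
- apply: card_le_trans (card_square Linf); exact: card_le_prod.
- apply: card_le_fun => //; exact: card_le_trans natL (card_le_powerset L).
- exact: Aa0.
- by have [] := pickP (~` \bigcup_i U (fun l => f (i, l), m i)).
exists C; split=> //; apply/Gdelta_space_closureP => W [Wn Wo ->] Wp.
apply: contrapT => CW.
have /choice[idx idxP] : forall n, exists g : nat -> (L -> X) * nat,
    (forall k, forall l, C ((g k).1 l)) /\ C `\` Wn n `<=` \bigcup_k U (g k).
  move=> n; pose D := [set gm : (L -> X) * nat | forall l, C (gm.1 l)].
  have nEp : ~ closure (C `\` Wn n) p.
    move=> Ep; have : (closure (C `\` Wn n) `&` Wn n) p by split=> //; exact: Wp.
    by rewrite closure_open_disjoint // setDE -setIA setICl setI0.
  have [||||g [gD gE]] := @lindelof_closed_seq X _ D ((fun=> a0), 0) U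
      (closure (C `\` Wn n)) XL.
  - exact: closed_closure.
  - by [].
  - by move=> gm _; have [/(_ gm.2)[]] := VP (range gm.1).
  - move=> x Ex; have [S [SE SL Sx]] := XT _ _ Ex.
    have nSp : ~ closure S p by apply: contra_not nEp; exact: closureS.
    have [g Sg] := card_le_range SL (closure_nonempty Sx).
    have [_ /(_ nSp _ Sx)[m _ Vx]] := VP S.
    exists (g, m); last by rewrite /U /= -Sg.
    by move=> l; have [] : (C `\` Wn n) (g l) by apply: SE; rewrite Sg; exists l.
  - by exists g; split=> //; exact: subset_trans (@subset_closure _ _) gE.
pose m (i : nat * nat) := (idx i.1 i.2).2.
pose f (w : (nat * nat) * L) := (idx w.1.1 w.1.2).1 w.2.
have fU i : U (fun l => f (i, l), m i) = U (idx i.1 i.2) by [].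
have CU : C `<=` \bigcup_i U (fun l => f (i, l), m i).
  move=> x Cx; have [n nWx] : exists n, ~ Wn n x.
    apply: contrapT => nn; apply: CW; exists x; split=> // n _.
    by apply: contrapT => nWx; apply: nn; exists n.
  have [_ /(_ x)[//|k _ Ux]] := idxP n.
  by exists (n, k).
have AU : A `<=` \bigcup_i U (fun l => f (i, l), m i).
  move=> y Ay; apply: contrapT => nUy.
  have Cpick : C (Phi m f) by apply: CPhi => w; have [Cg _] := idxP w.1.1; exact: Cg.
  have [_] := pickP (~` \bigcup_i U (fun l => f (i, l), m i)).
  by move=> /(_ (ex_intro _ y (conj Ay nUy))) nUpick; exact/nUpick/CU.
have Vi i : open (U (idx i.1 i.2)) /\ ~ closure (U (idx i.1 i.2)) p.
  by have [/(_ (idx i.1 i.2).2)] := VP (range (idx i.1 i.2).1).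
have [||y [/AU[i _]]] := Ap (\bigcap_i ~` closure (U (idx i.1 i.2))).
- by apply: Gdelta_bigcap => i; exact/closed_openC/closed_closure.
- by move=> i _; case: (Vi i).
- by rewrite fU => Uy /(_ i I); apply; exact: subset_closure.
Qed.

(** A code [g] is a sequence of small sets, and [H g] is the intersection of their
closures; [sel g] is a member of the cover containing [H g], if there is one.
Close [C] off so that countable unions of the open sets defining the
[sel g], with [g] in [C], cover [C] only if they cover the space.

The union of these sets [sel g] contains the closure of [C]: if [x] is a limit
of a small [S] and [A] is a member of the cover around [x], then
[Gdelta_closures] gives neighbourhoods [Un n] of [x], and the sets [S `&` Un n]
code an [H g] between [x] and [A]. If the selected sets missed a point [q], each
could be enlarged to an open set missing [q]; countably many of these cover the
closure of [C], and so they cover the space, yet they miss [q]. *)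
Lemma Gdelta_lindelof_number (X : topologicalType) (L : Type) (G : set (set X)) :
  hausdorff_space X -> lindelof_space X -> infinite_set [set: L] ->
  tightness_le X L ->
  (forall A, G A -> Gdelta A) -> \bigcup_(A in G) A = [set: X] ->
  exists G', [/\ G' `<=` G, G' #<= [set: set L] & \bigcup_(A in G') A = [set: X]].
Proof.
move=> XH XL Linf XT GG GX.
have [x0|X0] := pselect (exists x : X, True); last first.
  by exists set0; split=> //; apply/seteqP; split=> // x _; case: X0; exists x.
have {x0} [x0 _] := x0.
have [A0 GA0 _] : (\bigcup_(A in G) A) x0 by rewrite GX.
have /choice[W WP] : forall A : set X, exists W : nat -> set X,
    G A -> (forall n, open (W n)) /\ A = \bigcap_n W n.
  move=> A; have [/GG[W Wo AW]|nA] := pselect (G A); first by exists W.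
  by exists (fun=> set0).
pose code := ((nat * nat) * L -> X)%type.
pose H (g : code) := \bigcap_n closure (range (fun l => g (n, l))).
have /choice[sel selP] : forall g : code, exists A, G A /\
    forall B, G B -> H g `<=` B -> H g `<=` A.
  move=> g; have [[B [GB HB]]|nB] := pselect (exists B, G B /\ H g `<=` B).
    by exists B.
  by exists A0; split=> // B GB HB; case: nB; exists B.
have selG g : G (sel g) by have [] := selP g.
have /choice[pick pickP] : forall P : set X, exists a, P !=set0 -> P a.
  by move=> P; have [[a Pa]|nP] := pselect (P !=set0); [exists a|exists x0].
pose U (gm : code * nat) := W (sel gm.1) gm.2.
pose Phi (m : nat -> nat) (f : nat * ((nat * nat) * L) -> X) :=
  pick (~` \bigcup_i U (fun w => f (i, w), m i)).
have natL : [set: nat] #<= [set: L] by exact/infiniteP.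
have natnatL : [set: nat * nat] #<= [set: L] by rewrite (card_le_eql card_nat2).
have codeL : [set: (nat * nat) * L] #<= [set: L].
  by apply: card_le_trans (card_square Linf); exact: card_le_prod.
have [||//|//|C [Cx0 _ CL CPhi]] := @op_closure L _ _ _ Phi x0 setT Linf.
- by apply: card_le_trans (card_square Linf); exact: card_le_prod.
- by apply: card_le_fun => //; exact: card_le_trans natL (card_le_powerset L).
exists (sel @` [set g | forall w, C (g w)]); split.
- by move=> _ [g _ <-].
- have -> : sel @` [set g | forall w, C (g w)] =
      range (fun g : (nat * nat) * L -> set_type C => sel (fun w => val (g w))).
    apply/seteqP; split=> _ [g Cg <-].
      by exists (fun w => SigSub (mem_set (Cg w))).
    by exists (fun w => val (g w)) => // w; exact: set_valP.
  apply: card_le_trans (card_image_le _ _) _; apply: card_le_fun => //.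
  by rewrite (card_le_eql (card_setT C)).
apply/seteqP; split=> // q _; apply: contrapT => nq.
have nselq (g : code) : (forall w, C (g w)) -> exists m, ~ U (g, m) q.
  move=> Cg; apply: contrapT => nm; apply: nq; exists (sel g); first by exists g.
  have [_ ->] := WP _ (selG g); move=> m _.
  by apply: contrapT => nU; apply: nm; exists m.
have [m0 nU0] := nselq (fun=> x0) (fun=> Cx0).
pose D := [set gm : code * nat | (forall w, C (gm.1 w)) /\ ~ U gm q].
have [||||idx [idxD idxE]] := @lindelof_closed_seq X _ D ((fun=> x0), m0) U
  (closure C) XL.
- exact: closed_closure.
- by [].
- by move=> [g m] _; have [/(_ m)] := WP _ (selG g).
- move=> x Cx; have [S [SC SL Sx]] := XT _ _ Cx.
  have [A GA Ax] : (\bigcup_(A in G) A) x by rewrite GX.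
  have [Un [Unx UnA]] := Gdelta_closures XH XL (GG A GA) Ax.
  have /choice[g gP] : forall n, exists g : L -> X, S `&` Un n = range g.
    move=> n; apply: card_le_range.
      apply: card_le_trans SL; apply: subset_card_le; exact: subIsetl.
    by apply: Sx; apply: open_nbhs_nbhs; have [] := Unx n.
  pose g' (w : (nat * nat) * L) := g w.1 w.2.
  have Cg w : C (g' w).
    case: w => n l; apply: SC.
    by have [] : (S `&` Un n) (g n l) by rewrite gP; exists l.
  have Hx : H g' x.
    move=> n _ N Nx; rewrite /g' /= -gP.
    have [Uno Unx'] := Unx n.
    have [y [Sy [Ny Uy]]] : S `&` (N `&` Un n) !=set0.
      by apply: Sx; apply: filterI => //; exact: open_nbhs_nbhs.
    by exists y.
  have HA : H g' `<=` A.
    move=> y Hy; apply: UnA => n _; apply: closureS (Hy n I).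
    by rewrite /g' /= -gP; exact: subIsetr.
  have [m nU] := nselq g' Cg.
  exists (g', m) => //; rewrite /U /=.
  have [_ /(_ A GA HA x Hx)] := selP g'.
  by have [_ {1}->] := WP _ (selG g'); apply.
pose m n := (idx n).2; pose f (w : nat * ((nat * nat) * L)) := (idx w.1).1 w.2.
have fU n : U (fun w => f (n, w), m n) = U (idx n) by [].
have Cpick : C (Phi m f) by apply: CPhi => -[n w]; have [Cg _] := idxD n; exact: Cg.
have := pickP (~` \bigcup_i U (fun w => f (i, w), m i)).
case.
  by exists q => -[n _]; rewrite fU; case: (idxD n).
have /idxE[n _ Un] := subset_closure Cpick.
by exists n.
Qed.

(** * Free sequences in the G-delta topology *)

(** A longer free sequence can be cut down to length (2^k)^+, a regular cardinal.
Regularity is used twice: a limit of the sequence is a limit of a bounded part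
of it, by [Gdelta_tightness], and the tails missed by the members of a subcover
of size 2^k have a common point. *)
Lemma Gdelta_free_sequence_bound (X : topologicalType) (L : Type) :
  hausdorff_space X -> lindelof_space X -> infinite_set [set: L] ->
  tightness_le X L -> free_sequence_bound (Gdelta_space X) (set L).
Proof.
move=> XH XL Linf XT; have Minf := infinite_powerset Linf.
split=> // K0 le0 y0 [wo0 _] y0free; apply: contrapT => y0L.
have K0L : ~ ([set: K0] #<= [set: set L]).
  by apply: contra_not y0L; apply: card_le_trans; exact: card_image_le.
have [K [le [e [wo le_e KL KsL]]]] := successor_cardinal_sub wo0 K0L.
have [k _] : [set: K] !=set0.
  by apply/set0P/eqP => K0e; apply: KL; rewrite K0e.
pose y a : X := y0 (e a).
have avoid_tail x : exists G : set X,
    [/\ Gdelta G, G x & exists b, forall a, le b a -> ~ G (y a)].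
  suff [c nx] : exists c, ~ closure (y @` [set a | le c a] : set (Gdelta_space X)) x.
    have [G [GG Gx yG]] := Gdelta_not_closure nx.
    exists G; split=> //; exists c => a ca Ga.
    suff : (@set0 X) (y a) by []; rewrite -yG.
    by split=> //; exists a.
  have [xy|nxy] := pselect (closure (range y : set (Gdelta_space X)) x); last first.
    exists k; apply: contra_not nxy; apply: closureS => _ [a _ <-].
    by exists a.
  have [S [Sy SL Sx]] := Gdelta_tightness XH XL Linf XT xy.
  have /choice[i iP] : forall z, exists a, S z -> y a = z.
    move=> z; have [/Sy[a _ <-]|nS] := pselect (S z); first by exists a.
    have [s /Sy[a _ _]] := closure_nonempty Sx.
    by exists a.
  have [|c cP] := successor_regular (D := i @` S) wo Minf KL KsL.
    exact: card_le_trans (card_image_le _ _) SL.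
  exists c => xc; have /seteqP[/(_ x) + _] := y0free (e c); apply; split.
    apply: closureS Sx => z Sz; exists (e (i z)); last exact: iP.
    by rewrite /= le_e; apply: cP; exists z.
  by apply: closureS xc => _ [a /= ca <-]; exists (e a); rewrite /= ?le_e.
have [|//|G' [G'G G'L G'X]] := Gdelta_lindelof_number (L := L)
    (G := [set G : set X | Gdelta G /\ exists b, forall a, le b a -> ~ G (y a)])
    XH XL Linf XT.
- by move=> G [].
- apply/seteqP; split=> // x _; have [G [GG Gx Gb]] := avoid_tail x.
  by exists G.
have /choice[b bP] : forall G : set X, exists b, G' G ->
    forall a, le b a -> ~ G (y a).
  move=> G; have [/G'G[_ [b ?]]|nG] := pselect (G' G); first by exists b.
  by exists k.
have [|c cP] := successor_regular (D := b @` G') wo Minf KL KsL.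
  exact: card_le_trans (card_image_le _ _) G'L.
have [G G'_G Gyc] : (\bigcup_(G in G') G) (y c) by rewrite G'X.
apply: (bP G G'_G c) => //; apply: (wo_ltW wo); apply: cP.
by exists G.
Qed.

Theorem corollary11 (X : topologicalType) :
  hausdorff_space X -> lindelof_space X -> pseudoradial_space X ->
  [set: free_number (Gdelta_space X)] #<= [set: set (free_number X)].
Proof.
move=> XH XL Xpr.
have [XF _] := free_numberP X; have [_ least] := free_numberP (Gdelta_space X).
apply: least; have [Linf _] := XF.
apply: Gdelta_free_sequence_bound => //.
exact: small_tightness XF.
Qed.
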